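(* For all $X,Y,Z\in\Gamma(D)$, \begin{align*} \pi^{D^\bot}\big(\overline{R}(X,Y)Z\big)=&-\pi^{D^{\bot}}[[X,Y]^{D^{\bot}},Z]+\overline{B}(X,\overline{\nabla}^D_YZ)-\overline{B}(Y,\overline{\nabla}^D_XZ)-\overline{B}([X,Y]^{D},Z)\\ &+\overline{L}^{\bot}_X(\overline{B}(Y,Z))-\overline{L}^{\bot}_Y(\overline{B}(X,Z))-\overline{L}^{\bot}_Z([X,Y]^{D^{\bot}}). \end{align*}
   Context: $(M,g)$ is a smooth Riemannian manifold with Levi-Civita connection $\nabla$. $D\subseteq TM$ is a smooth subbundle (distribution) of constant rank $n$ that is non integrable, i.e. there are $X,Y\in\Gamma(D)$ with $[X,Y]\notin\Gamma(D)$. $D^\bot$ is its orthogonal complement, $\pi^D:TM\to D$ and $\pi^{D^\bot}:TM\to D^\bot$ are the orthogonal projections, $[X,Y]^D=\pi^D[X,Y]$, $[X,Y]^{D^\bot}=\pi^{D^\bot}[X,Y]$. $(M,g,\overline\nabla)$ is a statistical manifold: $\overline\nabla_XY=\nabla_XY+K(X,Y)$, where $K$ is a $(1,2)$-tensor field such that $C(X,Y,Z)=g(K(X,Y),Z)$ is totally symmetric. For $X,Y\in\Gamma(D)$: $\overline\nabla^D_XY=\pi^D(\overline\nabla_XY)$, $\overline B(X,Y)=\pi^{D^\bot}(\overline\nabla_XY)$. For $X\in\Gamma(D)$, $\xi\in\Gamma(D^\bot)$: $\overline L^\bot_X\xi=\pi^{D^\bot}(\overline\nabla_X\xi)$. The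 curvature of $\overline\nabla$ is $\overline R(X,Y)Z=\overline\nabla_X\overline\nabla_YZ-\overline\nabla_Y\overline\nabla_XZ-\overline\nabla_{[X,Y]}Z$. *)

(* Defs.v *)
From HB Require Import structures.
From mathcomp Require Import all_boot all_order all_algebra.
From mathcomp Require Import all_classical all_reals all_analysis.
From mathcomp Require Import ring.

Set Implicit Arguments.
Unset Strict Implicit.
Unset Printing Implicit Defensive.

Import Order.TTheory GRing.Theory Num.Theory.
Import numFieldNormedType.Exports.

Local Open Scope classical_set_scope.
Local Open Scope ring_scope.

(** * Smooth functions on open subsets of R^m *)

(* [U] is always an open set below; the functions are total, and their values
   outside [U] are irrelevant. *)
Fixpoint Ck (R : realType) (m k : nat) (U : set 'rV[R]_m)
    (f : 'rV[R]_m -> R^o) : Prop :=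
  (forall x, U x -> {for x, continuous f}) /\
  if k is k'.+1 then
    forall i : 'I_m, (forall x, U x -> derivable f x (delta_mx 0 i)) /\
                     Ck k' U ('D_(delta_mx 0 i) f)
  else True.

Definition smooth_Rm (R : realType) (m : nat) (U : set 'rV[R]_m)
  (f : 'rV[R]_m -> R^o) : Prop := forall k, Ck k U f.

Section SmoothRm.
Variables (R : realType) (m : nat).
Implicit Types (U V : set 'rV[R]_m) (f g : 'rV[R]_m -> R^o).

Lemma Ck_cont k U f : Ck k U f -> forall x, U x -> {for x, continuous f}.
Proof. by case: k => [|k] []. Qed.

Lemma CkS k U f : Ck k.+1 U f -> Ck k U f.
Proof.
elim: k f => [|k IH] f [fc fd]; split=> // i.
by have [fdi fk] := fd i; split=> //; exact: IH.
Qed.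

Lemma near_open_eq U f g : open U -> (forall x, U x -> f x = g x) ->
  forall x, U x -> \forall y \near x, f y = g y.
Proof.
move=> oU fg x Ux; have Unx : nbhs x U by exact: open_nbhs_nbhs (conj oU Ux).
exact: filterS Unx.
Qed.

Lemma continuous_congr U f g : open U -> (forall x, U x -> f x = g x) ->
  (forall x, U x -> {for x, continuous f}) ->
  forall x, U x -> {for x, continuous g}.
Proof.
move=> oU fg fc x Ux; rewrite /prop_for /continuous_at -(fg _ Ux).
exact: cvg_trans (near_eq_cvg (near_open_eq oU fg Ux)) (fc x Ux).
Qed.

Lemma Ck_congr k U f g : open U -> (forall x, U x -> f x = g x) ->
  Ck k U f -> Ck k U g.
Proof.
move=> oU; elim: k f g => [|k IH] f g fg [fc fd]; split=> //.
1,2: exact: continuous_congr fc.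
move=> i; have [fdi fk] := fd i; split.
  by move=> x Ux; apply: near_eq_derivable (near_open_eq oU fg Ux) (fdi x Ux).
apply: IH fk => x Ux; apply: near_eq_derive; exact: near_open_eq Ux.
Qed.

Lemma Ck_local k V f :
  (forall x, V x -> exists U, [/\ U x & Ck k U f]) -> Ck k V f.
Proof.
elim: k f => [|k IH] f fV; split=> //.
- by move=> x /fV[U [Ux [fc _]]]; exact: fc.
- by move=> x /fV[U [Ux [fc _]]]; exact: fc.
- move=> i; split; first by move=> x /fV[U [Ux [_ /(_ i) [fd _]]]]; exact: fd.
  by apply: IH => x /fV[U [Ux [_ /(_ i) [_ fk]]]]; exists U.
Qed.

Lemma Ck_cst k U (a : R^o) : open U -> Ck k U (fun=> a).
Proof.
move=> oU; elim: k a => [|k IH] a; split=> //.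
1,2: by move=> x _; exact: (@cst_continuous _ R^o a).
move=> i; split=> [x _|]; first exact: derivable_cst.
apply: (@Ck_congr k U (fun=> 0)) => // x _.
by rewrite derive_cst.
Qed.

Lemma Ck_add k U f g : open U -> Ck k U f -> Ck k U g -> Ck k U (f + g).
Proof.
move=> oU; elim: k f g => [|k IH] f g [fc fd] [gc gd]; split=> //.
1,2: by move=> x Ux; apply: continuousD; [exact: fc|exact: gc].
move=> i; have [fdi fk] := fd i; have [gdi gk] := gd i; split.
  by move=> x Ux; apply: derivableD; [exact: fdi|exact: gdi].
apply: Ck_congr (IH _ _ fk gk) => // x Ux.
by rewrite deriveD; [|exact: fdi|exact: gdi].
Qed.

Lemma Ck_mul k U f g : open U -> Ck k U f -> Ck k U g -> Ck k U (f * g).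
Proof.
move=> oU; elim: k f g => [|k IH] f g fk1 gk1.
  case: fk1 gk1 => [fc _] [gc _]; split=> // x Ux.
  by apply: continuousM; [exact: fc|exact: gc].
have [fk0 gk0] := (CkS fk1, CkS gk1).
case: fk1 gk1 => [fc fd] [gc gd]; split.
  by move=> x Ux; apply: continuousM; [exact: fc|exact: gc].
move=> i; have [fdi fk] := fd i; have [gdi gk] := gd i; split.
  by move=> x Ux; apply: derivableM; [exact: fdi|exact: gdi].
apply: Ck_congr (Ck_add oU (IH _ _ fk0 gk) (IH _ _ gk0 fk)) => // x Ux.
by rewrite deriveM; [|exact: fdi|exact: gdi].
Qed.

Lemma Ck_inv k U f : open U -> (forall x, U x -> f x != 0) ->
  Ck k U f -> Ck k U (fun x => (f x)^-1).
Proof.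
move=> oU f0; elim: k => [|k IH] fk1.
  case: fk1 => [fc _]; split=> // x Ux.
  by apply: continuousV; [exact: f0|exact: fc].
have ik := IH (CkS fk1); case: fk1 => [fc fd]; split.
  by move=> x Ux; apply: continuousV; [exact: f0|exact: fc].
move=> i; have [fdi fk] := fd i; split.
  by move=> x Ux; apply: derivableV; [exact: f0|exact: fdi].
apply: Ck_congr (Ck_mul oU (Ck_cst k (-1) oU) (Ck_mul oU (Ck_mul oU ik ik) fk))
  => // x Ux.
rewrite deriveV; [|exact: f0|exact: fdi].
rewrite -[LHS]/(-1 * ((f x)^-1 * (f x)^-1 * 'D_(delta_mx 0 i) f x)).
by rewrite mulN1r scaleNr -expr2 exprVn.
Qed.

End SmoothRm.

(** * Smooth manifolds and smooth functions *)

(* A chart is a homeomorphism [chart_to] from the open set [chart_dom] onto the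
   open set [chart_cod], with inverse [chart_from]. *)
Record chart (R : realType) (m : nat) (T : topologicalType) := Chart {
  chart_dom : set T;
  chart_cod : set 'rV[R]_m;
  chart_to : T -> 'rV[R]_m;
  chart_from : 'rV[R]_m -> T;
  chart_dom_open : open chart_dom;
  chart_cod_open : open chart_cod;
  chart_to_cod : forall p, chart_dom p -> chart_cod (chart_to p);
  chart_from_dom : forall x, chart_cod x -> chart_dom (chart_from x);
  chart_toK : forall p, chart_dom p -> chart_from (chart_to p) = p;
  chart_fromK : forall x, chart_cod x -> chart_to (chart_from x) = x;
  chart_to_cont : forall p, chart_dom p -> {for p, continuous chart_to};
  chart_from_cont : forall x, chart_cod x -> {for x, continuous chart_from}
}.

Record manifold (R : realType) (m : nat) := Manifold {
  manifold_top :> topologicalType;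
  manifold_hausdorff : hausdorff_space manifold_top;
  manifold_second_countable : @second_countable manifold_top;
  (* not required to be maximal *)
  atlas : set (chart R m manifold_top);
  atlas_cover : forall p : manifold_top,
    exists c, atlas c /\ chart_dom c p;
  atlas_smooth : forall c c', atlas c -> atlas c' -> forall j : 'I_m,
    smooth_Rm (chart_cod c `&` chart_from c @^-1` chart_dom c')
              (fun x => chart_to c' (chart_from c x) 0 j)
}.

Definition smooth_on (R : realType) (m : nat) (M : manifold R m) (U : set M)
    (h : M -> R^o) : Prop :=
  forall c, atlas c ->
    smooth_Rm (chart_cod c `&` chart_from c @^-1` U) (h \o chart_from c).

Section SmoothOn.
Variables (R : realType) (m : nat) (M : manifold R m).
Implicit Types (U V : set M) (h k : M -> R^o).

Lemma chart_preimage_open (c : chart R m M) U :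
  open U -> open (chart_cod c `&` chart_from c @^-1` U).
Proof.
move=> oU; rewrite openE => x [cx Ux].
have cn : nbhs x (chart_cod c).
  by apply: open_nbhs_nbhs; split=> //; exact: chart_cod_open.
have Un : nbhs (chart_from c x) U by apply: open_nbhs_nbhs.
exact: filterI cn (chart_from_cont cx Un).
Qed.

Lemma smooth_on_congr U h k : open U -> (forall p, U p -> h p = k p) ->
  smooth_on U h -> smooth_on U k.
Proof.
move=> oU hk hU c ac n; apply: Ck_congr (hU c ac n).
  exact: chart_preimage_open.
by move=> x [_ Ux]; exact: hk.
Qed.

Lemma smooth_on_local h :
  (forall p, exists U, [/\ open U, U p & smooth_on U h]) -> smooth_on setT h.
Proof.
move=> hl c ac n; apply: Ck_local => x [cx _].
have [U [oU Ux hU]] := hl (chart_from c x).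
by exists (chart_cod c `&` chart_from c @^-1` U); split=> //; exact: hU.
Qed.

Lemma smooth_on_sub U V h : U `<=` V -> smooth_on V h -> smooth_on U h.
Proof.
move=> UV hV c ac n; apply: Ck_local => x [cx Ux].
exists (chart_cod c `&` chart_from c @^-1` V); split; last exact: hV.
by split=> //; exact: UV.
Qed.

Lemma smooth_on_cst U (a : R) : open U -> smooth_on U (fun=> a).
Proof. by move=> oU c ac n; apply: Ck_cst; exact: chart_preimage_open. Qed.

Lemma smooth_on_add U h k : open U -> smooth_on U h -> smooth_on U k ->
  smooth_on U (fun p => h p + k p).
Proof.
move=> oU hU kU c ac n.
exact: Ck_add (chart_preimage_open oU) (hU c ac n) (kU c ac n).
Qed.

Lemma smooth_on_mul U h k : open U -> smooth_on U h -> smooth_on U k ->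
  smooth_on U (fun p => h p * k p).
Proof.
move=> oU hU kU c ac n.
exact: Ck_mul (chart_preimage_open oU) (hU c ac n) (kU c ac n).
Qed.

Lemma smooth_on_inv U h : open U -> (forall p, U p -> h p != 0) ->
  smooth_on U h -> smooth_on U (fun p => (h p)^-1).
Proof.
move=> oU h0 hU c ac n.
apply: Ck_inv (chart_preimage_open oU) _ (hU c ac n).
by move=> x [_ Ux]; exact: h0.
Qed.

Lemma smooth_on_opp U h : open U -> smooth_on U h -> smooth_on U (fun p => - h p).
Proof.
move=> oU hU; apply: smooth_on_congr (smooth_on_mul oU (smooth_on_cst (-1) oU) hU)
  => // p _; exact: mulN1r.
Qed.

Lemma smooth_on_sum (I : Type) (r : seq I) (P : pred I) U
    (h : I -> M -> R^o) : open U ->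
  (forall i, smooth_on U (h i)) -> smooth_on U (fun p => \sum_(i <- r | P i) h i p).
Proof.
move=> oU hU; elim: r => [|i r IH].
  apply: smooth_on_congr (smooth_on_cst 0 oU) => // p _; by rewrite big_nil.
case Pi: (P i).
  apply: smooth_on_congr (smooth_on_add oU (hU i) IH) => // p _.
  by rewrite big_cons Pi.
by apply: smooth_on_congr IH => // p _; rewrite big_cons Pi.
Qed.

Lemma smooth_on_prod (I : Type) (r : seq I) (P : pred I) U
    (h : I -> M -> R^o) : open U ->
  (forall i, smooth_on U (h i)) -> smooth_on U (fun p => \prod_(i <- r | P i) h i p).
Proof.
move=> oU hU; elim: r => [|i r IH].
  apply: smooth_on_congr (smooth_on_cst 1 oU) => // p _; by rewrite big_nil.
case Pi: (P i).
  apply: smooth_on_congr (smooth_on_mul oU (hU i) IH) => // p _.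
  by rewrite big_cons Pi.
by apply: smooth_on_congr IH => // p _; rewrite big_cons Pi.
Qed.

Lemma smooth_on_det n U (A : M -> 'M[R]_n) : open U ->
  (forall i j, smooth_on U (fun p => A p i j)) -> smooth_on U (fun p => \det (A p)).
Proof.
move=> oU AU; rewrite /determinant; apply: smooth_on_sum => // s.
by apply: smooth_on_mul => //; [exact: smooth_on_cst|exact: smooth_on_prod].
Qed.

Lemma smooth_on_invmx n U (A : M -> 'M[R]_n) : open U ->
  (forall p, U p -> A p \in unitmx) ->
  (forall i j, smooth_on U (fun p => A p i j)) ->
  forall i j, smooth_on U (fun p => invmx (A p) i j).
Proof.
move=> oU Au AU i j.
have iU : smooth_on U (fun p => (\det (A p))^-1).
  apply: smooth_on_inv => //; last exact: smooth_on_det.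
  by move=> p /Au; rewrite unitmxE unitfE.
have cU : smooth_on U (fun p => cofactor (A p) j i).
  apply: smooth_on_mul => //; first exact: smooth_on_cst.
  apply: smooth_on_det => // k l.
  by apply: smooth_on_congr (AU (lift j k) (lift i l)) => // p _; rewrite !mxE.
apply: smooth_on_congr (smooth_on_mul oU iU cU) => // p Up.
by rewrite /invmx (Au p Up) !mxE.
Qed.

Definition smooth_pred : {pred (M -> R^o)} := fun h => `[< smooth_on setT h >].

Lemma smooth_pred_subring : subring_closed smooth_pred.
Proof.
split.
- by apply/asboolP; exact: (smooth_on_cst 1 openT).
- move=> h k /asboolP hU /asboolP kU; apply/asboolP.
  exact: smooth_on_add openT hU (smooth_on_opp openT kU).
- move=> h k /asboolP hU /asboolP kU; apply/asboolP.
  exact: smooth_on_mul openT hU kU.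
Qed.

Lemma smooth_pred_submod : submod_closed smooth_pred.
Proof.
split.
- by apply/asboolP; exact: (smooth_on_cst 0 openT).
- move=> a h k /asboolP hU /asboolP kU; apply/asboolP.
  exact: smooth_on_add openT (smooth_on_mul openT (smooth_on_cst a openT) hU) kU.
Qed.

End SmoothOn.

Record Cinf (R : realType) (m : nat) (M : manifold R m) := MkCinf {
  cinf_val :> M -> R^o;
  cinfP : cinf_val \in @smooth_pred R m M
}.

HB.instance Definition _ (R : realType) (m : nat) (M : manifold R m) :=
  [isSub of Cinf M for @cinf_val R m M].
HB.instance Definition _ (R : realType) (m : nat) (M : manifold R m) :=
  [Choice of Cinf M by <:].
HB.instance Definition _ (R : realType) (m : nat) (M : manifold R m) :=
  GRing.SubChoice_isSubComPzRing.Build _ _ (Cinf M) (@smooth_pred_subring R m M).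
HB.instance Definition _ (R : realType) (m : nat) (M : manifold R m) :=
  GRing.SubZmodule_isSubLmodule.Build _ _ _ (Cinf M) (@smooth_pred_submod R m M).

Section CinfTheory.
Variables (R : realType) (m : nat) (M : manifold R m).
Implicit Types f h : Cinf M.

Lemma cinf_smooth f : smooth_on setT f.
Proof. exact/asboolP/(cinfP f). Qed.

Lemma cinf_ext f h : (forall p, f p = h p) -> f = h.
Proof. by move=> fh; apply: val_inj; apply/funext. Qed.

Definition mk_cinf (h : M -> R^o) (hs : smooth_on setT h) : Cinf M :=
  MkCinf (asboolT hs : h \in @smooth_pred R m M).

Lemma cinfD f h p : (f + h) p = f p + h p.
Proof. by []. Qed.
Lemma cinfN f p : (- f) p = - f p.
Proof. by []. Qed.
Lemma cinfM f h p : (f * h) p = f p * h p.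
Proof. by []. Qed.
Lemma cinf1 p : (1 : Cinf M) p = 1.
Proof. by []. Qed.
Lemma cinfZ (a : R) f p : (a *: f) p = a * f p.
Proof. by []. Qed.
End CinfTheory.

(** * Tangent vectors *)

(* T_p M is the space of derivations of C^oo(M) at p *)
Definition derivation_at (R : realType) (m : nat) (M : manifold R m) (p : M)
    (v : Cinf M -> R^o) : Prop :=
  (forall (a : R) f h, v (a *: f + h) = a * v f + v h) /\
  (forall f h, v (f * h) = v f * h p + f p * v h).

Definition tangent_pred (R : realType) (m : nat) (M : manifold R m) (p : M) :
  {pred (Cinf M -> R^o)} := fun v => `[< derivation_at p v >].

Record tangent (R : realType) (m : nat) (M : manifold R m) (p : M) := MkTangent {
  tangent_val :> Cinf M -> R^o;
  tangentP : tangent_val \in tangent_pred p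
}.

Lemma tangent_pred_submod (R : realType) (m : nat) (M : manifold R m) (p : M) :
  submod_closed (tangent_pred p).
Proof.
split.
  have Z f : (0 : Cinf M -> R^o) f = 0 by [].
  apply/asboolP; split=> [a f h|f h]; rewrite !Z.
  - by rewrite mulr0 addr0.
  - by rewrite mul0r mulr0 addr0.
move=> b u v /asboolP[ul uL] /asboolP[vl vL]; apply/asboolP.
have E f : (b *: u + v) f = b * u f + v f by [].
split=> [a f h|f h]; rewrite !E.
- by rewrite ul vl; ring.
- by rewrite uL vL; ring.
Qed.

HB.instance Definition _ (R : realType) (m : nat) (M : manifold R m) (p : M) :=
  [isSub of tangent p for @tangent_val R m M p].
HB.instance Definition _ (R : realType) (m : nat) (M : manifold R m) (p : M) :=
  [Choice of tangent p by <:].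
HB.instance Definition _ (R : realType) (m : nat) (M : manifold R m) (p : M) :=
  GRing.SubChoice_isSubLmodule.Build _ _ _ (tangent p)
    (@tangent_pred_submod R m M p).

Section TangentTheory.
Variables (R : realType) (m : nat) (M : manifold R m) (p : M).
Implicit Types (u v : tangent p) (f h : Cinf M).

Lemma tangent_linear v (a : R) f h : v (a *: f + h) = a * v f + v h.
Proof. by have /asboolP[+ _] := tangentP v; exact. Qed.

Lemma tangent_leibniz v f h : v (f * h) = v f * h p + f p * v h.
Proof. by have /asboolP[_ +] := tangentP v; exact. Qed.

Definition mk_tangent (v : Cinf M -> R^o) (vd : derivation_at p v) : tangent p :=
  MkTangent (asboolT vd : v \in tangent_pred p).

Lemma tangent_ext u v : (forall f, u f = v f) -> u = v.
Proof. by move=> uv; apply: val_inj; apply/funext. Qed.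

Lemma tangentD u v f : (u + v) f = u f + v f.
Proof. by []. Qed.
Lemma tangentN u f : (- u) f = - u f.
Proof. by []. Qed.
Lemma tangent0 f : (0 : tangent p) f = 0.
Proof. by []. Qed.
Lemma tangentZ (a : R) u f : (a *: u) f = a * u f.
Proof. by []. Qed.
Lemma tangent_sum (I : Type) (r : seq I) (P : pred I) (u : I -> tangent p) f :
  (\sum_(i <- r | P i) u i) f = \sum_(i <- r | P i) u i f.
Proof.
elim: r => [|i r IH]; first by rewrite !big_nil.
by rewrite !big_cons; case: (P i); rewrite -IH.
Qed.
End TangentTheory.

(** * Vector fields *)

(* Testing a local field against global functions is enough, because M has
   smooth bump functions. *)
Definition smooth_field_on (R : realType) (m : nat) (M : manifold R m)
    (U : set M) (X : forall p : M, tangent p) : Prop :=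
  forall f : Cinf M, smooth_on U (fun p => X p f).

Record vfield (R : realType) (m : nat) (M : manifold R m) := MkVfield {
  vfield_at :> forall p : M, tangent p;
  vfield_smooth : smooth_field_on setT vfield_at
}.

Lemma vfield_ext (R : realType) (m : nat) (M : manifold R m) (X Y : vfield M) :
  (forall p, X p = Y p) -> X = Y.
Proof.
case: X Y => [X Xs] [Y Ys] /= XY.
have E : X = Y by exact: functional_extensionality_dep.
by case: Y / E Ys {XY} => Ys; congr MkVfield; exact: Prop_irrelevance.
Qed.

HB.instance Definition _ (R : realType) (m : nat) (M : manifold R m) :=
  gen_eqMixin (vfield M).
HB.instance Definition _ (R : realType) (m : nat) (M : manifold R m) :=
  gen_choiceMixin (vfield M).

Section VfieldModule.
Variables (R : realType) (m : nat) (M : manifold R m).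
Implicit Types (X Y : vfield M) (f h : Cinf M).

Lemma vfield0_smooth : smooth_field_on setT (fun p : M => 0 : tangent p).
Proof. by move=> f; exact: (smooth_on_cst 0 openT). Qed.

Lemma vfieldN_smooth X : smooth_field_on setT (fun p => - X p).
Proof. by move=> f; exact: smooth_on_opp openT (vfield_smooth X f). Qed.

Lemma vfieldD_smooth X Y : smooth_field_on setT (fun p => X p + Y p).
Proof.
by move=> f; exact: smooth_on_add openT (vfield_smooth X f) (vfield_smooth Y f).
Qed.

Lemma vfieldZ_smooth h X : smooth_field_on setT (fun p => (h p : R) *: X p).
Proof.
by move=> f; exact: smooth_on_mul openT (cinf_smooth h) (vfield_smooth X f).
Qed.

Definition vfield0 := MkVfield vfield0_smooth.
Definition vfieldN X := MkVfield (@vfieldN_smooth X).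
Definition vfieldD X Y := MkVfield (@vfieldD_smooth X Y).
Definition vfieldZ h X := MkVfield (@vfieldZ_smooth h X).

Lemma vfield_addA : associative vfieldD.
Proof. by move=> X Y Z; apply: vfield_ext => p; exact: addrA. Qed.
Lemma vfield_addC : commutative vfieldD.
Proof. by move=> X Y; apply: vfield_ext => p; exact: addrC. Qed.
Lemma vfield_add0 : left_id vfield0 vfieldD.
Proof. by move=> X; apply: vfield_ext => p; exact: add0r. Qed.
Lemma vfield_addN : left_inverse vfield0 vfieldN vfieldD.
Proof. by move=> X; apply: vfield_ext => p; exact: addNr. Qed.

HB.instance Definition _ := GRing.isZmodule.Build (vfield M)
  vfield_addA vfield_addC vfield_add0 vfield_addN.

Lemma vfield_scaleA f h X : vfieldZ f (vfieldZ h X) = vfieldZ (f * h) X.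
Proof. by apply: vfield_ext => p; exact: scalerA. Qed.
Lemma vfield_scale1 : left_id 1 vfieldZ.
Proof. by move=> X; apply: vfield_ext => p; exact: scale1r. Qed.
Lemma vfield_scaleDr : right_distributive vfieldZ +%R.
Proof. by move=> f X Y; apply: vfield_ext => p; exact: scalerDr. Qed.
Lemma vfield_scaleDl X : {morph vfieldZ^~ X : f h / f + h}.
Proof. by move=> f h; apply: vfield_ext => p; exact: scalerDl. Qed.

HB.instance Definition _ := GRing.Zmodule_isLmodule.Build (Cinf M) (vfield M)
  vfield_scaleA vfield_scale1 vfield_scaleDr vfield_scaleDl.

Lemma vfield_atD X Y p : (X + Y) p = X p + Y p.
Proof. by []. Qed.
Lemma vfield_atN X p : (- X) p = - X p.
Proof. by []. Qed.
Lemma vfield_atZ h X p : (h *: X) p = (h p : R) *: X p.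
Proof. by []. Qed.

Definition vapp X f : Cinf M := mk_cinf (vfield_smooth X f).

Lemma vapp_linear X (a : R) f h : vapp X (a *: f + h) = a *: vapp X f + vapp X h.
Proof. by apply: cinf_ext => p; exact: tangent_linear. Qed.

Lemma vapp_leibniz X f h : vapp X (f * h) = vapp X f * h + f * vapp X h.
Proof. by apply: cinf_ext => p; exact: tangent_leibniz. Qed.

Lemma lie_derivation X Y (p : M) :
  derivation_at p (fun f => X p (vapp Y f) - Y p (vapp X f)).
Proof.
split=> [a f h|f h].
  by rewrite !vapp_linear !tangent_linear; ring.
rewrite !vapp_leibniz.
have D (Z : vfield M) (u v : Cinf M) : Z p (u + v) = Z p u + Z p v.
  by have := tangent_linear (Z p) 1 u v; rewrite scale1r mul1r.
rewrite !D !tangent_leibniz /=; ring.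
Qed.

Lemma lie_smooth X Y :
  smooth_field_on setT (fun p => mk_tangent (@lie_derivation X Y p)).
Proof.
move=> f; apply: smooth_on_add openT (vfield_smooth X (vapp Y f)) _.
exact: smooth_on_opp openT (vfield_smooth Y (vapp X f)).
Qed.

Definition lie X Y : vfield M := MkVfield (@lie_smooth X Y).

End VfieldModule.

(** * Riemannian metrics, connections, statistical manifolds *)

Record riemannian_metric (R : realType) (m : nat) (M : manifold R m) := Metric {
  metric_at :> forall p : M, tangent p -> tangent p -> R;
  metric_sym : forall p (u v : tangent p), metric_at u v = metric_at v u;
  metric_linear : forall p (a : R) (u v w : tangent p),
    metric_at (a *: u + v) w = a * metric_at u w + metric_at v w;
  metric_pos : forall p (v : tangent p), v != 0 -> 0 < metric_at v v;
  metric_smooth : forall (U : set M) (X Y : forall p : M, tangent p), open U ->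
    smooth_field_on U X -> smooth_field_on U Y ->
    smooth_on U (fun p => metric_at (X p) (Y p))
}.

(* (1,2)-tensor fields *)
Record tensor12 (R : realType) (m : nat) (M : manifold R m) := Tensor12 {
  tensor_at :> forall p : M, tangent p -> tangent p -> tangent p;
  tensor_linearl : forall p (a : R) (u v w : tangent p),
    tensor_at (a *: u + v) w = a *: tensor_at u w + tensor_at v w;
  tensor_linearr : forall p (a : R) (u v w : tangent p),
    tensor_at w (a *: u + v) = a *: tensor_at w u + tensor_at w v;
  tensor_smooth : forall (U : set M) (X Y : forall p : M, tangent p), open U ->
    smooth_field_on U X -> smooth_field_on U Y ->
    smooth_field_on U (fun p => tensor_at (X p) (Y p))
}.

Section Geometry.
Variables (R : realType) (m : nat) (M : manifold R m).
Implicit Types (g : riemannian_metric M) (K : tensor12 M) (X Y Z : vfield M).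

Definition metric_app g X Y : Cinf M :=
  mk_cinf (metric_smooth g openT (vfield_smooth X) (vfield_smooth Y)).

Definition tensor_app K X Y : vfield M :=
  MkVfield (tensor_smooth K openT (vfield_smooth X) (vfield_smooth Y)).

Record is_connection (nabla : vfield M -> vfield M -> vfield M) : Prop := {
  conn_linearl : forall (f : Cinf M) X Y Z,
    nabla (f *: X + Y) Z = f *: nabla X Z + nabla Y Z;
  conn_addr : forall X Y Z, nabla X (Y + Z) = nabla X Y + nabla X Z;
  (* constant f gives R-homogeneity in the second argument *)
  conn_leibniz : forall (f : Cinf M) X Y,
    nabla X (f *: Y) = vapp X f *: Y + f *: nabla X Y
}.

Definition torsion_free (nabla : vfield M -> vfield M -> vfield M) : Prop :=
  forall X Y, nabla X Y - nabla Y X = lie X Y.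

Definition metric_compatible g (nabla : vfield M -> vfield M -> vfield M) : Prop :=
  forall X Y Z, vapp X (metric_app g Y Z) =
    metric_app g (nabla X Y) Z + metric_app g Y (nabla X Z).

Definition levi_civita g nabla : Prop :=
  [/\ is_connection nabla, torsion_free nabla & metric_compatible g nabla].

Definition totally_symmetric g K : Prop :=
  forall (p : M) (u v w : tangent p),
    g p (K p u v) w = g p (K p v u) w /\ g p (K p u v) w = g p (K p u w) v.

Definition stat_connection (nabla : vfield M -> vfield M -> vfield M) K X Y :
  vfield M := nabla X Y + tensor_app K X Y.

Definition curvature (nabla : vfield M -> vfield M -> vfield M) X Y Z : vfield M :=
  nabla X (nabla Y Z) - nabla Y (nabla X Z) - nabla (lie X Y) Z.

End Geometry.

(** * Distributions *)

Definition is_basis (R : realType) (V : lmodType R) (n : nat) (S : set V)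
    (e : 'I_n -> V) : Prop :=
  (forall c : 'I_n -> R, \sum_i c i *: e i = 0 -> forall i, c i = 0) /\
  S = range (fun c : 'I_n -> R => \sum_i c i *: e i).

(* smooth subbundles of rank n of TM *)
Record subbundle (R : realType) (m : nat) (M : manifold R m) (n : nat) :=
  Subbundle {
    fiber :> forall p : M, set (tangent p);
    local_frame : forall p : M, exists (U : set M)
        (E : 'I_n -> forall q : M, tangent q),
      [/\ open U, U p, forall i, smooth_field_on U (E i) &
          forall q, U q -> is_basis (@fiber q) (fun i => E i q)]
  }.

Definition perp (R : realType) (m : nat) (M : manifold R m) (g : riemannian_metric M)
    (S : forall p : M, set (tangent p)) (p : M) : set (tangent p) :=
  [set v | forall w, S p w -> g p v w = 0].

Definition is_section (R : realType) (m : nat) (M : manifold R m)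
    (S : forall p : M, set (tangent p)) (X : vfield M) : Prop :=
  forall p, S p (X p).

Definition non_integrable (R : realType) (m : nat) (M : manifold R m)
    (S : forall p : M, set (tangent p)) : Prop :=
  exists X Y, [/\ is_section S X, is_section S Y & ~ is_section S (lie X Y)].

(* the orthogonal projection of T_p M onto S p; [xget]'s default value 0 is
   never used when S is a subbundle or the complement of one *)
Definition oproj (R : realType) (m : nat) (M : manifold R m) (g : riemannian_metric M)
    (S : forall p : M, set (tangent p)) (p : M) (v : tangent p) : tangent p :=
  xget 0 [set u | S p u /\ perp g S (v - u)].

Section Projection.
Variables (R : realType) (m : nat) (M : manifold R m) (g : riemannian_metric M).
Variables (n : nat) (D : subbundle M n).

Lemma metricDl p (u v w : tangent p) : g p (u + v) w = g p u w + g p v w.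
Proof. by have := metric_linear g 1 u v w; rewrite scale1r mul1r. Qed.
Lemma metric0l p (w : tangent p) : g p 0 w = 0.
Proof. by apply: (addrI (g p 0 w)); rewrite -metricDl !addr0. Qed.
Lemma metricZl p (a : R) (u w : tangent p) : g p (a *: u) w = a * g p u w.
Proof. by have := metric_linear g a u 0 w; rewrite !addr0 metric0l addr0. Qed.
Lemma metricNl p (u w : tangent p) : g p (- u) w = - g p u w.
Proof. by rewrite -scaleN1r metricZl mulN1r. Qed.
Lemma metricBl p (u v w : tangent p) : g p (u - v) w = g p u w - g p v w.
Proof. by rewrite metricDl metricNl. Qed.
Lemma metric_suml p (I : Type) (r : seq I) (P : pred I) (u : I -> tangent p) w :
  g p (\sum_(i <- r | P i) u i) w = \sum_(i <- r | P i) g p (u i) w.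
Proof.
elim: r => [|i r IH]; first by rewrite !big_nil metric0l.
by rewrite !big_cons; case: (P i); rewrite ?metricDl IH.
Qed.
Lemma metric_eq0 p (v : tangent p) : g p v v = 0 -> v = 0.
Proof.
by move=> v0; apply/eqP; apply: contraT => /(metric_pos g); rewrite v0 ltxx.
Qed.

Lemma fiber_sub p (u v : tangent p) : D p u -> D p v -> D p (u - v).
Proof.
have [U [E [_ Up _ /(_ p Up)[_ ->]]]] := local_frame D p.
move=> [a _ <-] [b _ <-]; exists (fun i => a i - b i) => //=.
by rewrite -sumrB; apply: eq_bigr => i _; rewrite scalerBl.
Qed.

Section Frame.
Variables (U : set M) (E : 'I_n -> forall q : M, tangent q).
Hypothesis EB : forall q, U q -> is_basis (D q) (fun i => E i q).

Definition gram (q : M) : 'M[R]_n := \matrix_(i, j) g q (E i q) (E j q).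
Definition frame_coef (q : M) (v : tangent q) (j : 'I_n) : R :=
  \sum_i g q v (E i q) * invmx (gram q) i j.

Lemma gram_unit q : U q -> gram q \in unitmx.
Proof.
move=> /EB[free _]; rewrite -row_free_unit -kermx_eq0.
apply/eqP/row_matrixP => k; rewrite row0.
have := mulmx_ker (gram q) => /(congr1 (row k)); rewrite row_mul row0.
move: (row k _) => c cG; apply/rowP => i; rewrite [RHS]mxE.
pose w := \sum_i c 0 i *: E i q.
have wE j : g q w (E j q) = 0.
  have := congr1 (fun A : 'rV_n => A 0 j) cG; rewrite !mxE => <-.
  by rewrite metric_suml; apply: eq_bigr => l _; rewrite metricZl mxE.
apply: (free (fun i => c 0 i)); apply: metric_eq0.
rewrite -/w {1}/w metric_suml big1 // => l _.
by rewrite metricZl metric_sym wE mulr0.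
Qed.

Lemma frame_proj q (v : tangent q) : U q ->
  D q (\sum_j frame_coef v j *: E j q) /\
  perp g D (v - \sum_j frame_coef v j *: E j q).
Proof.
move=> Uq; have [_ DE] := EB Uq.
split; first by rewrite DE; exists (frame_coef v).
move=> w; rewrite DE => -[c _ <-].
rewrite metric_sym metric_suml big1 // => k _.
rewrite metricZl metric_sym metricBl metric_suml.
suff -> : \sum_j g q (frame_coef v j *: E j q) (E k q) = g q v (E k q).
  by rewrite subrr mulr0.
pose b := \row_i g q v (E i q).
have := mulmxKV (gram_unit Uq) b => /(congr1 (fun A : 'rV_n => A 0 k)).
rewrite [RHS]mxE mxE => <-; apply: eq_bigr => j _.
rewrite metricZl !mxE; congr (_ * _).
by apply: eq_bigr => i _; rewrite mxE.
Qed.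

End Frame.

Lemma oproj_unique (S : forall p : M, set (tangent p)) p (u v w : tangent p) :
  (forall x y : tangent p, S p x -> S p y -> S p (x - y)) ->
  S p u -> perp g S (v - u) -> S p w -> perp g S (v - w) -> u = w.
Proof.
move=> SB Su pu Sw pw; apply/eqP; rewrite -subr_eq0; apply/eqP/metric_eq0.
have E : u - w = (v - w) - (v - u) by rewrite opprB [RHS]addrC subrKA.
by rewrite {1}E metricBl (pu _ (SB _ _ Su Sw)) (pw _ (SB _ _ Su Sw)) subrr.
Qed.

Lemma oprojE (S : forall p : M, set (tangent p)) p (u v : tangent p) :
  (forall x y : tangent p, S p x -> S p y -> S p (x - y)) ->
  S p u -> perp g S (v - u) -> oproj g S v = u.
Proof.
move=> SB Su pu; rewrite /oproj; case: xgetP => [w _ [Sw pw]|/(_ u)].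
  exact: oproj_unique SB Sw pw Su pu.
by case; split.
Qed.

Lemma oproj_fiber p (v : tangent p) :
  D p (oproj g D v) /\ perp g D (v - oproj g D v).
Proof.
have [U [E [oU Up Es EB]]] := local_frame D p.
have [Du pu] := frame_proj EB v Up.
by rewrite (oprojE (@fiber_sub p) Du pu).
Qed.

Lemma perp_sub p (u v : tangent p) :
  perp g D u -> perp g D v -> perp g D (u - v).
Proof. by move=> pu pv w Dw; rewrite metricBl pu // pv // subrr. Qed.

Lemma oproj_perp p (v : tangent p) : oproj g (perp g D) v = v - oproj g D v.
Proof.
have [Du pu] := oproj_fiber v.
apply: oprojE => //; first exact: perp_sub.
by rewrite opprB addrC subrK => w pw; rewrite metric_sym pw.
Qed.

Lemma oproj_smooth (X : vfield M) :
  smooth_field_on setT (fun p => oproj g D (X p)).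
Proof.
move=> f; apply: smooth_on_local => p.
have [U [E [oU Up Es EB]]] := local_frame D p.
exists U; split=> //.
have XU : smooth_field_on U X.
  by move=> h; apply: smooth_on_sub (vfield_smooth X h).
apply: (@smooth_on_congr _ _ _ U
  (fun q => \sum_j frame_coef E (X q) j * E j q f)) => //.
  move=> q Uq; have [Du pu] := frame_proj EB (X q) Uq.
  by rewrite (oprojE (@fiber_sub q) Du pu) tangent_sum.
apply: smooth_on_sum => // j; apply: smooth_on_mul => //; last exact: Es.
apply: smooth_on_sum => // i; apply: smooth_on_mul => //.
  exact: metric_smooth.
apply: smooth_on_invmx => // [q|k l]; first exact: gram_unit.
apply: smooth_on_congr (metric_smooth g oU (Es k) (Es l)) => // q _.
by rewrite mxE.
Qed.

Lemma oproj_perp_smooth (X : vfield M) :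
  smooth_field_on setT (fun p => oproj g (perp g D) (X p)).
Proof.
move=> f; apply: smooth_on_congr (vfieldD_smooth X
  (vfieldN (MkVfield (oproj_smooth X))) f) => //; first exact: openT.
by move=> p _; rewrite oproj_perp.
Qed.

Definition projD (X : vfield M) : vfield M := MkVfield (oproj_smooth X).
Definition projDperp (X : vfield M) : vfield M := MkVfield (oproj_perp_smooth X).

(* The operators induced on D by a connection [nabla] of M.  They are used on
   X, Y in Gamma(D) and xi in Gamma(D^perp). *)
Variable nabla : vfield M -> vfield M -> vfield M.

Definition connD (X Y : vfield M) : vfield M := projD (nabla X Y).
Definition secondB (X Y : vfield M) : vfield M := projDperp (nabla X Y).
Definition normalL (X xi : vfield M) : vfield M := projDperp (nabla X xi).

End Projection.

(* Main.v *)
Require Import Defs.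
From HB Require Import structures.
From mathcomp Require Import all_boot all_order all_algebra.
From mathcomp Require Import all_classical all_reals all_analysis.

Set Implicit Arguments.
Unset Strict Implicit.
Unset Printing Implicit Defensive.

Import Order.TTheory GRing.Theory Num.Theory.
Local Open Scope ring_scope.

(** Write the tangent bundle as the orthogonal sum of [D] and its complement.
    The two projections are additive and add up to the identity, so the
    D-perp part of [nabla X W] is the sum of [secondB X] on the D-part of [W]
    and [normalL X] on its D-perp part ([projDperp_conn]).  This turns the two
    second-order terms of the curvature into the [B] and [L] terms of the
    formula.

    The term [nabla (lie X Y) Z] is split along its first argument instead.
    The D-part of the bracket gives a [B] term.  The D-perp part [xi] gives
    [nabla xi Z], which is not one of the operators induced on [D], since it
    differentiates in a direction transverse to [D]; the absence of torsion
    exchanges the arguments, [nabla xi Z = nabla Z xi + lie xi Z], and produces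
    the last [L] term and the bracket term; for sections of an integrable
    [D] both vanish with [xi] ([codazzi_torsion_free]).

    This argument applies to every torsion-free connection.  The statistical
    connection is one: it differs from the Levi-Civita connection by the tensor
    [K], and total symmetry of [g (K u v) w] makes [K] symmetric, so that it
    does not contribute to the torsion ([stat_connection_torsion_free]). *)

Section OrthogonalSplitting.
Variables (R : realType) (m n : nat) (M : manifold R m).
Variables (g : riemannian_metric M) (D : subbundle M n).
Implicit Types X : vfield M.

(** Differences of projections still satisfy the two conditions that
    characterize the orthogonal projection. *)
Lemma projD_zmod : zmod_morphism (projD g D).
Proof.
move=> X Y; apply: vfield_ext => p /=.
have [DX pX] := oproj_fiber g D (X p); have [DY pY] := oproj_fiber g D (Y p).
apply: oprojE; [exact: fiber_sub|exact: fiber_sub|].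
have -> : (X - Y) p - (oproj g D (X p) - oproj g D (Y p)) =
    (X p - oproj g D (X p)) - (Y p - oproj g D (Y p)).
  by rewrite vfield_atD vfield_atN !opprD addrACA.
exact: perp_sub.
Qed.

HB.instance Definition _ :=
  GRing.isZmodMorphism.Build _ _ (projD g D) projD_zmod.

Lemma projDperpE X : projDperp g D X = X - projD g D X.
Proof. by apply: vfield_ext => p; exact: oproj_perp. Qed.

Lemma projD_perpK X : projD g D X + projDperp g D X = X.
Proof. by rewrite projDperpE addrC subrK. Qed.

Lemma projDperp_zmod : zmod_morphism (projDperp g D).
Proof. by move=> X Y; rewrite !projDperpE raddfB !opprD addrACA. Qed.

HB.instance Definition _ :=
  GRing.isZmodMorphism.Build _ _ (projDperp g D) projDperp_zmod.

End OrthogonalSplitting.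

Section StatisticalConnection.
Variables (R : realType) (m : nat) (M : manifold R m).
Implicit Types (g : riemannian_metric M) (K : tensor12 M).
Implicit Types nabla : vfield M -> vfield M -> vfield M.

Lemma tensor_app_linearl K (f : Cinf M) (X Y Z : vfield M) :
  tensor_app K (f *: X + Y) Z = f *: tensor_app K X Z + tensor_app K Y Z.
Proof. by apply: vfield_ext => p; exact: tensor_linearl. Qed.

Lemma tensor_app_linearr K (f : Cinf M) (X Y Z : vfield M) :
  tensor_app K Z (f *: X + Y) = f *: tensor_app K Z X + tensor_app K Z Y.
Proof. by apply: vfield_ext => p; exact: tensor_linearr. Qed.

Lemma tensor_appZr K (f : Cinf M) (X Z : vfield M) :
  tensor_app K Z (f *: X) = f *: tensor_app K Z X.
Proof.
have tensor0 : tensor_app K Z 0 = 0.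
  have := tensor_app_linearr K 1 0 0 Z; rewrite !scale1r addr0 => /eqP.
  by rewrite -subr_eq0 opprD addrA subrr sub0r oppr_eq0 => /eqP.
by have := tensor_app_linearr K f X 0 Z; rewrite tensor0 !addr0.
Qed.

Lemma stat_connection_is_connection nabla K :
  is_connection nabla -> is_connection (stat_connection nabla K).
Proof.
move=> [lin_l add_r leibniz]; split=> [f X Y Z|X Y Z|f X Y]; rewrite /stat_connection.
- by rewrite lin_l tensor_app_linearl scalerDr addrACA.
- have := tensor_app_linearr K 1 Y Z X; rewrite !scale1r => ->.
  by rewrite add_r addrACA.
- by rewrite leibniz tensor_appZr scalerDr addrA.
Qed.

(** The metric is nondegenerate, so the symmetry of [g (K u v) w] in [u] and
    [v] passes to [K]. *)
Lemma totally_symmetric_sym g K : totally_symmetric g K ->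
  forall X Y, tensor_app K X Y = tensor_app K Y X.
Proof.
move=> symK X Y; apply: vfield_ext => p /=.
apply/eqP; rewrite -subr_eq0; apply/eqP/(metric_eq0 (g := g)).
set w := (X in g p _ X).
by rewrite metricBl (symK p (X p) (Y p) w).1 subrr.
Qed.

Lemma stat_connection_torsion_free g nabla K : totally_symmetric g K ->
  torsion_free nabla -> torsion_free (stat_connection nabla K).
Proof.
move=> symK tf X Y; rewrite /stat_connection (totally_symmetric_sym symK Y X).
by rewrite opprD addrACA subrr addr0.
Qed.

End StatisticalConnection.

Section Codazzi.
Variables (R : realType) (m n : nat) (M : manifold R m).
Variables (g : riemannian_metric M) (D : subbundle M n).
Variable nabla : vfield M -> vfield M -> vfield M.
Hypothesis conn_nabla : is_connection nabla.

Lemma conn_addl X Y Z : nabla (X + Y) Z = nabla X Z + nabla Y Z.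
Proof. by have := conn_linearl conn_nabla 1 X Y Z; rewrite !scale1r. Qed.

Lemma projDperp_conn X W : projDperp g D (nabla X W) =
  secondB g D nabla X (projD g D W) + normalL g D nabla X (projDperp g D W).
Proof. by rewrite -{1}(projD_perpK g D W) conn_addr // raddfD. Qed.

(** The Codazzi equation of a submanifold, corrected by the two terms in
    [projDperp g D (lie X Y)] that measure the failure of integrability. *)
Lemma codazzi_torsion_free : torsion_free nabla -> forall X Y Z : vfield M,
  projDperp g D (curvature nabla X Y Z) =
    - projDperp g D (lie (projDperp g D (lie X Y)) Z)
    + secondB g D nabla X (connD g D nabla Y Z)
    - secondB g D nabla Y (connD g D nabla X Z)
    - secondB g D nabla (projD g D (lie X Y)) Z
    + normalL g D nabla X (secondB g D nabla Y Z)
    - normalL g D nabla Y (secondB g D nabla X Z)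
    - normalL g D nabla Z (projDperp g D (lie X Y)).
Proof.
move=> tf X Y Z.
set xi := projDperp g D (lie X Y).
(* [nabla xi Z] differentiates across [D]: torsion-freeness swaps the arguments. *)
have transverse : projDperp g D (nabla (lie X Y) Z) =
    secondB g D nabla (projD g D (lie X Y)) Z
    + (normalL g D nabla Z xi + projDperp g D (lie xi Z)).
  rewrite -{1}(projD_perpK g D (lie X Y)) conn_addl raddfD -/xi; congr (_ + _).
  by rewrite -tf raddfB addrC subrK.
rewrite /curvature !raddfB /= transverse.
rewrite (projDperp_conn X (nabla Y Z)) (projDperp_conn Y (nabla X Z)).
by rewrite !opprD !addrA [LHS](ACl (7*1*3*5*2*4*6)).
Qed.

End Codazzi.

Theorem theorem4p2 (R : realType) (m n : nat) (M : manifold R m) (g : riemannian_metric M)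
    (nabla : vfield M -> vfield M -> vfield M) (hnabla : levi_civita g nabla)
    (K : tensor12 M) (hK : totally_symmetric g K)
    (D : subbundle M n) (hD : non_integrable D)
    (X Y Z : vfield M) (hX : is_section D X) (hY : is_section D Y) (hZ : is_section D Z) :
  let nablabar := stat_connection nabla K in
  let piD := projD g D in
  let piDp := projDperp g D in
  let nablaD := connD g D nablabar in
  let B := secondB g D nablabar in
  let L := normalL g D nablabar in
  piDp (curvature nablabar X Y Z) =
    - piDp (lie (piDp (lie X Y)) Z)
    + B X (nablaD Y Z) - B Y (nablaD X Z) - B (piD (lie X Y)) Z
    + L X (B Y Z) - L Y (B X Z) - L Z (piDp (lie X Y)).
Proof.
have [conn_nabla tf_nabla _] := hnabla.
apply: codazzi_torsion_free; first exact: stat_connection_is_connection.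
exact: stat_connection_torsion_free hK tf_nabla.
Qed.
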